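(* Let $W\in\mathbb{R}^{n\times n}$ be symmetric positive definite, let $T\in\mathbb{R}^{n\times n}$ be symmetric, indefinite and nonsingular, let $A=W+\mathrm{i}T$, and let $V\in\mathbb{R}^{n\times n}$ be symmetric positive definite. Let $\tilde\lambda_{\max}$ be the largest eigenvalue of $V^{-1}W$ and let $\tilde\mu_{\min}>0$ be the smallest absolute value of an eigenvalue of $V^{-1}T$. Then $\tilde\alpha^{*}=\tilde\mu_{\min}^{2}/\tilde\lambda_{\max}$ minimizes $$\tilde\sigma(\alpha)=\frac{\tilde\lambda_{\max}}{\alpha+\tilde\lambda_{\max}}\cdot\frac{\sqrt{\alpha^{2}+\tilde\mu_{\min}^{2}}}{\tilde\mu_{\min}}$$ over $\alpha>0$, and the PLHSS iteration with parameter $\alpha=\tilde\alpha^{*}$ converges to the solution of $Ax=b$ for every $b\in\mathbb{C}^n$ and every initial vector $x^{(0)}\in\mathbb{C}^n$.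
   Context: A real symmetric matrix is indefinite if it has at least one positive and at least one negative eigenvalue. The PLHSS iteration with preconditioner $V$ and parameter $\alpha>0$ for $Ax=b$ is, from $x^{(0)}\in\mathbb{C}^n$ and for $k=0,1,2,\dots$, $$(\alpha V+W)x^{(k+1/2)}=(\alpha V-\mathrm{i}T)x^{(k)}+b,\qquad Tx^{(k+1)}=\mathrm{i}Wx^{(k+1/2)}-\mathrm{i}b.$$ (The function $\tilde\sigma(\alpha)$ is the upper bound used for the spectral radius of its iteration matrix $\mathrm{i}T^{-1}W(\alpha V+W)^{-1}(\alpha V-\mathrm{i}T)$.) *)

(* Defs.v *)
From HB Require Import structures.
From mathcomp Require Import all_boot all_order all_algebra.
From mathcomp Require Import all_classical all_reals all_analysis.
From mathcomp Require Import complex.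

Set Implicit Arguments.
Unset Strict Implicit.
Unset Printing Implicit Defensive.

Import Order.TTheory GRing.Theory Num.Theory.
Import numFieldNormedType.Exports.

Local Open Scope classical_set_scope.
Local Open Scope ring_scope.
Local Open Scope complex_scope.

(* The topology on R[i] is the one induced by the modulus; vectors over R[i]
   then inherit the library's topology on matrices (entrywise convergence). *)
HB.instance Definition _ (R : realType) := NormedModule.copy R[i] R[i]^o.

Section RealMatrices.
Variables (R : realType) (n : nat).
Implicit Types (M : 'M[R]_n) (a lam mu : R).

Definition sym_posdef M : Prop :=
  M \is symmetricmx /\
  forall v : 'cV[R]_n, v != 0 -> 0 < (v^T *m M *m v) 0 0.

(* To be used with M symmetric, so that all its eigenvalues are real. *)
Definition indefinite M : Prop :=
  (exists2 a, eigenvalue M a & 0 < a) /\ (exists2 a, eigenvalue M a & a < 0).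

(* The next two notions range over real eigenvalues only. They are applied to
   V^-1 W and V^-1 T with V symmetric positive definite and W, T symmetric;
   these are similar to V^(-1/2) W V^(-1/2) and V^(-1/2) T V^(-1/2), so all
   their complex eigenvalues are real. *)
Definition largest_eigenvalue M lam : Prop :=
  eigenvalue M lam /\ forall a, eigenvalue M a -> a <= lam.

Definition smallest_abs_eigenvalue M mu : Prop :=
  (exists2 a, eigenvalue M a & mu = `|a|) /\
  forall a, eigenvalue M a -> mu <= `|a|.

Definition complexify M : 'M[R[i]]_n := map_mx (real_complex R) M.

End RealMatrices.

Section PLHSS.
Variables (R : realType) (n : nat).

(* y k stands for the half step x^(k+1/2). *)
Definition plhss_iteration (V W T : 'M[R]_n) (alpha : R) (b : 'cV[R[i]]_n)
    (x0 : 'cV[R[i]]_n) (x y : nat -> 'cV[R[i]]_n) : Prop :=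
  x 0%N = x0 /\
  forall k : nat,
    (alpha%:C *: complexify V + complexify W) *m y k =
      (alpha%:C *: complexify V - 'i%C *: complexify T) *m x k + b /\
    complexify T *m x k.+1 = 'i%C *: (complexify W *m y k) - 'i%C *: b.

(* For every right-hand side the system A x = b has a unique solution, the
   iteration can be carried out from every x0, and its iterates x^(k) converge
   to that solution. *)
Definition plhss_converges (V W T : 'M[R]_n) (alpha : R) (A : 'M[R[i]]_n) :
    Prop :=
  forall b x0 : 'cV[R[i]]_n,
    exists xs : 'cV[R[i]]_n,
      [/\ A *m xs = b,
          forall z : 'cV[R[i]]_n, A *m z = b -> z = xs,
          exists x y : nat -> 'cV[R[i]]_n,
            plhss_iteration V W T alpha b x0 x y &
          forall x y : nat -> 'cV[R[i]]_n,
            plhss_iteration V W T alpha b x0 x y -> x @ \oo --> xs].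

End PLHSS.

Definition sigma_tilde (R : realType) (lam mu alpha : R) : R :=
  lam / (alpha + lam) * (Num.sqrt (alpha ^+ 2 + mu ^+ 2) / mu).

(* Main.v *)
(* With V-weighted norms, |x|_V^2 = x^T V x and |y|_{V^-1}^2 = y^T V^-1 y, the
   pencil eigenvalues give W <= lambda V, hence
   |W f|_{V^-1}^2 <= lambda f^T W f, and mu |x|_V <= |T x|_{V^-1}.  For the
   errors e of x^(k), f of x^(k+1/2) and e' of x^(k+1),
   (alpha V + W) f = (alpha V - iT) e and T e' = i W f.  Taking V^-1-norms, the
   cross terms on the right cancel because T is symmetric, so
     |(alpha V + W) f|^2 = alpha^2 |e|_V^2 + |T e|^2
                        <= (alpha^2 / mu^2 + 1) |T e|^2,
   while |T e'| = |W f| <= lambda / (alpha + lambda) |(alpha V + W) f|.  Hence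
   |T e'|_{V^-1} <= sigma_tilde(alpha) |T e|_{V^-1}, and at the minimizer
   sigma_tilde^2 = lambda^2 / (lambda^2 + mu^2) < 1. *)
Require Import Defs.
From mathcomp Require Import all_boot all_order all_algebra.
From mathcomp Require Import all_classical all_reals all_analysis.
From mathcomp Require Import complex.
From mathcomp Require Import ring lra.

Import Order.TTheory GRing.Theory Num.Theory.
Import numFieldNormedType.Exports.

Local Open Scope ring_scope.
Local Open Scope complex_scope.

(** * Bilinear forms of real matrices and the Cauchy-Schwarz inequality *)

Section BilinearForms.
Context {R : realFieldType} {n : nat}.
Implicit Types (M N : 'M[R]_n) (x y z : 'cV[R]_n).

Definition bform M x y : R := (x^T *m M *m y) 0 0.

Lemma bformDl M x y z : bform M (x + y) z = bform M x z + bform M y z.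
Proof. by rewrite /bform raddfD !mulmxDl mxE. Qed.

Lemma bformDr M x y z : bform M x (y + z) = bform M x y + bform M x z.
Proof. by rewrite /bform mulmxDr mxE. Qed.

Lemma bformZl M a x y : bform M (a *: x) y = a * bform M x y.
Proof. by rewrite /bform linearZ -!scalemxAl mxE. Qed.

Lemma bformZr M a x y : bform M x (a *: y) = a * bform M x y.
Proof. by rewrite /bform -scalemxAr mxE. Qed.

Lemma bformNl M x y : bform M (- x) y = - bform M x y.
Proof. by rewrite -scaleN1r bformZl mulN1r. Qed.

Lemma bformNr M x y : bform M x (- y) = - bform M x y.
Proof. by rewrite -scaleN1r bformZr mulN1r. Qed.

Lemma bformDm M N x y : bform (M + N) x y = bform M x y + bform N x y.
Proof. by rewrite /bform mulmxDr mulmxDl mxE. Qed.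

Lemma bformZm a M x y : bform (a *: M) x y = a * bform M x y.
Proof. by rewrite /bform -scalemxAr -scalemxAl mxE. Qed.

Lemma bformNm M x y : bform (- M) x y = - bform M x y.
Proof. by rewrite -scaleN1r bformZm mulN1r. Qed.

Lemma bform_mulr M N x y : bform M x (N *m y) = bform (M *m N) x y.
Proof. by rewrite /bform !mulmxA. Qed.

Lemma bform_mull M N x y : bform M (N *m x) y = bform (N^T *m M) x y.
Proof. by rewrite /bform trmx_mul !mulmxA. Qed.

Lemma bform_tr M x y : bform M^T x y = bform M y x.
Proof.
rewrite /bform -[in RHS](trmxK (y^T *m M *m x)) [RHS]mxE.
by rewrite !trmx_mul trmxK mulmxA.
Qed.

Lemma bformC M x y : M^T = M -> bform M x y = bform M y x.
Proof. by move=> MT; rewrite -bform_tr MT. Qed.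

Lemma bform0 M x : bform M 0 x = 0.
Proof. by rewrite /bform trmx0 !mul0mx mxE. Qed.

Lemma bform_delta M i j : bform M (delta_mx i 0) (delta_mx j 0) = M i j.
Proof. by rewrite /bform trmx_delta -rowE -colE !mxE. Qed.

(** The quadratic polynomial [bform M (x + t *: y) (x + t *: y)] in [t] is nonnegative, so its
    discriminant is not positive. Since [M] is only semidefinite, the leading coefficient may
    vanish. *)
Lemma bform_CauchySchwarz M x y : M^T = M -> (forall z, 0 <= bform M z z) ->
  bform M x y ^+ 2 <= bform M x x * bform M y y.
Proof.
move=> MT M0.
have Mt t : 0 <= bform M x x + 2 * t * bform M x y + t ^+ 2 * bform M y y.
  have := M0 (x + t *: y).
  rewrite !(bformDl, bformDr, bformZl, bformZr) (bformC M y x MT).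
  by congr (is_true (0 <= _)); ring.
have := M0 y; rewrite le_eqVlt => /predU1P[y0|y0].
  rewrite -y0 mulr0; have [->|xy0] := eqVneq (bform M x y) 0.
    by rewrite expr0n.
  (* With zero leading coefficient the polynomial is affine in [t]; this [t] is where it would take
     the value -1. *)
  have := Mt (- (bform M x x + 1) / (2 * bform M x y)).
  rewrite -y0 mulr0 addr0 => h.
  have e : bform M x x +
    2 * (- (bform M x x + 1) / (2 * bform M x y)) * bform M x y = -1 by field.
  by move: h; rewrite e; lra.
(* Evaluation at the vertex of the parabola. *)
have := Mt (- bform M x y / bform M y y).
set a := bform M x x; set b := bform M x y; set c := bform M y y => h.
have -> : b ^+ 2 = a * c - c * (a + 2 * (- b / c) * b + (- b / c) ^+ 2 * c).
  by field; exact: lt0r_neq0.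
have := mulr_ge0 (ltW y0) h; rewrite -/c => h'; lra.
Qed.

(** Cauchy-Schwarz of [x] against each basis vector shows that every entry of [M *m x] vanishes. *)
Lemma bform_isotropic M x : M^T = M -> (forall z, 0 <= bform M z z) ->
  bform M x x = 0 -> M *m x = 0.
Proof.
move=> MT M0 x0; apply/matrixP => i j; rewrite ord1 [RHS]mxE.
have -> : (M *m x) i 0 = bform M (delta_mx i 0) x.
  by rewrite /bform trmx_delta -rowE -row_mul [RHS]mxE.
have := bform_CauchySchwarz M (delta_mx i 0) x MT M0.
by rewrite x0 mulr0 => h; apply/eqP; rewrite -sqrf_eq0 eq_le h sqr_ge0.
Qed.

End BilinearForms.

Lemma symmetricmxP {R : fieldType} {n : nat} (M : 'M[R]_n) :
  reflect (M^T = M) (M \is symmetricmx).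
Proof.
apply: (iffP (is_hermitianmxP _ _ _)); rewrite expr0 scale1r map_mx_id //.
Qed.

(** * Positive definite matrices and Rayleigh bounds for symmetric pencils *)

Section PositiveDefinite.
Context {R : realType} {n : nat}.
Implicit Types (M S V W : 'M[R]_n) (x y : 'cV[R]_n).

Lemma posdef_sym M : sym_posdef M -> M^T = M.
Proof. by case=> /symmetricmxP. Qed.

Lemma posdef_gt0 M x : sym_posdef M -> x != 0 -> 0 < bform M x x.
Proof. by case=> _; apply. Qed.

Lemma posdef_ge0 M x : sym_posdef M -> 0 <= bform M x x.
Proof.
move=> hM; have [->|x0] := eqVneq x 0; first by rewrite bform0.
exact/ltW/posdef_gt0.
Qed.

Lemma posdef_eq0 M x : sym_posdef M -> bform M x x <= 0 -> x = 0.
Proof. by move=> hM; apply: contraTeq => x0; rewrite -ltNge posdef_gt0. Qed.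

Lemma unitmx_ker0 {F : fieldType} m (M : 'M[F]_m) :
  (forall x : 'cV_m, M *m x = 0 -> x = 0) -> M \in unitmx.
Proof.
move=> h; rewrite -unitmx_tr unitmxE unitfE; apply/det0P => -[v v0 vM].
move/negP: v0; apply; apply/eqP/trmx_inj; rewrite trmx0; apply: h.
by apply: trmx_inj; rewrite trmx_mul trmxK vM trmx0.
Qed.

Lemma posdef_unit M : sym_posdef M -> M \in unitmx.
Proof.
move=> hM; apply: unitmx_ker0 => x Mx; apply: (posdef_eq0 M) => //.
by rewrite /bform -mulmxA Mx mulmx0 mxE.
Qed.

Lemma posdef_inv M : sym_posdef M -> sym_posdef (invmx M).
Proof.
move=> hM; have MT := posdef_sym M hM; have uM := posdef_unit M hM.
split=> [|x x0]; first by apply/symmetricmxP; rewrite trmx_inv MT.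
rewrite -/(bform _ x x) -[x](mulKVmx uM) bform_mull bform_mulr MT.
rewrite -mulmxA mulVmx // mulmx1; apply: posdef_gt0 => //.
by apply: contraNneq x0 => ix0; rewrite -[x](mulKVmx uM) ix0 mulmx0.
Qed.

Lemma posdefD a M N : 0 < a -> sym_posdef M -> sym_posdef N ->
  sym_posdef (a *: M + N).
Proof.
move=> a0 hM hN; split=> [|x x0].
  by apply/symmetricmxP; rewrite raddfD /= linearZ /= !posdef_sym.
by rewrite -/(bform _ x x) bformDm bformZm addr_gt0 ?mulr_gt0 ?posdef_gt0.
Qed.

(** The coordinate [x i 0] is the [V]-inner product of [x] with [V^-1 e_i], whose squared [V]-norm
    is [invmx V i i]; apply Cauchy-Schwarz. *)
Lemma posdef_coord_le V x i : sym_posdef V ->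
  x i 0 ^+ 2 <= invmx V i i * bform V x x.
Proof.
move=> hV; have uV := posdef_unit V hV; have VT := posdef_sym V hV.
have := bform_CauchySchwarz V (invmx V *m delta_mx i 0) x VT
  (fun z => posdef_ge0 V z hV).
rewrite !bform_mull bform_mulr trmx_inv VT mulVmx // mul1mx bform_delta.
by rewrite /bform mulmx1 trmx_delta -rowE mxE.
Qed.

(** [eigenvalue] speaks of row vectors acting from the left. By symmetry of [S] and [V], the row
    eigenvector [(V *m x)^T] corresponds to the solution [x] of the generalized problem. *)
Lemma eigenvalue_pencilP S V a : S^T = S -> V^T = V -> V \in unitmx ->
  reflect (exists2 x : 'cV_n, x != 0 & S *m x = a *: (V *m x))
    (eigenvalue (invmx V *m S) a).
Proof.
move=> ST VT uV; apply: (iffP eigenvalueP) => [[v vS v0]|[x x0 Sx]].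
  exists (v *m invmx V)^T.
    rewrite trmx_eq0; apply: contraNneq v0 => v0.
    by rewrite -[v](mulmxKV uV) v0 mul0mx.
  apply: trmx_inj; rewrite linearZ /= !trmx_mul !trmxK ST VT -mulmxA vS.
  by rewrite mulmxKV.
exists (V *m x)^T.
  rewrite trmx_mul VT mulmxA mulmxK // -ST -trmx_mul Sx.
  by rewrite linearZ /= trmx_mul VT.
rewrite trmx_eq0; apply: contraNneq x0 => x0.
by rewrite -[x](mulKmx uV) x0 mulmx0.
Qed.

Lemma sum_continuous {T : topologicalType} (I : finType) (f : I -> T -> R) :
  (forall j, continuous (f j)) -> continuous (fun v => \sum_j f j v).
Proof.
move=> fc; have addc : continuous (fun z : R * R => z.1 + z.2).
  exact: add_continuous.
exact: (@continuous_big R I +%R 0 xpredT addc _ _ f).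
Qed.

Lemma bform_tr_continuous M : continuous (fun v : 'rV[R]_n => bform M v^T v^T).
Proof.
have -> : (fun v : 'rV[R]_n => bform M v^T v^T) =
    (fun v => \sum_j (\sum_i v 0 i * M i j) * v 0 j).
  apply/funext => v; rewrite /bform trmxK mxE.
  by apply: eq_bigr => j _; rewrite !mxE.
refine (@sum_continuous _ _
  (fun j (v : 'rV[R]_n) => (\sum_i v 0 i * M i j) * v 0 j) _).
move=> j v; apply: continuousM; last exact: coord_continuous.
refine (@sum_continuous _ _ (fun i (v : 'rV[R]_n) => v 0 i * M i j) _ v).
move=> i {}v; apply: continuousM; first exact: coord_continuous.
exact: cst_continuous.
Qed.

(* The Rayleigh quotient attains its maximum on the compact ellipsoid
   [bform V x x = 1], and at a maximizer the positive semidefinite matrix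
   [m *: V - S] has an isotropic, hence kernel, vector. *)
Lemma rayleigh_max S V x0 : S^T = S -> sym_posdef V -> x0 != 0 ->
  exists2 m, eigenvalue (invmx V *m S) m &
    forall x, bform S x x <= m * bform V x x.
Proof.
move=> ST hV x00; have VT := posdef_sym V hV; have uV := posdef_unit V hV.
pose K := [set v : 'rV[R]_n | bform V v^T v^T = 1]%classic.
pose nrm x := (Num.sqrt (bform V x x))^-1 *: x.
have nrmV M x : x != 0 -> bform M (nrm x) (nrm x) = bform M x x / bform V x x.
  move=> xn0; have V0 := posdef_gt0 V x hV xn0.
  rewrite bformZl bformZr mulrA -invfM -expr2 sqr_sqrtr ?ltW // mulrC //.
have nrmK x : x != 0 -> K (nrm x)^T.
  by move=> xn0; rewrite /K /= trmxK nrmV // divff // gt_eqF // posdef_gt0.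
have cK : compact K.
  apply: bounded_closed_compact; last first.
    apply: (@closed_comp _ _ (fun v : 'rV[R]_n => bform V v^T v^T)
      [set 1]%classic).
      by move=> v _; exact: bform_tr_continuous.
    exact: closed_eq.
  (* On the ellipsoid the coordinate [j] is at most [Num.sqrt (invmx V j j)] in absolute value; the
     sum bounds all coordinates at once. *)
  exists (\sum_i Num.sqrt (invmx V i i)); split; first exact: num_real.
  move=> M ltM v Kv /=; rewrite [leLHS]/Num.norm /= mx_normrE.
  apply/bigmax_leP; split=> [|[i j] _ /=].
    by apply/ltW/(le_lt_trans _ ltM)/sumr_ge0 => i _; exact: sqrtr_ge0.
  rewrite ord1; apply/ltW/(le_lt_trans _ ltM).
  rewrite (bigD1 j) //= -[leLHS]addr0 lerD //; last first.
    by apply: sumr_ge0 => k _; exact: sqrtr_ge0.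
  rewrite -sqrtr_sqr ler_wsqrtr //.
  by have := posdef_coord_le V v^T j hV; rewrite Kv mulr1 mxE.
have K0 : (K !=set0)%classic by exists (nrm x0)^T; exact: nrmK.
have cf : {within K, continuous (fun v : 'rV[R]_n => bform S v^T v^T)}%classic.
  by apply: continuous_subspaceT; exact: bform_tr_continuous.
have [c cK' cmax] := EVT_max_rV K0 cK cf.
move: cK'; rewrite inE /K /= => Kc.
set m := bform S c^T c^T in cmax *.
have le_m z : bform S z z <= m * bform V z z.
  have [->|z0] := eqVneq z 0; first by rewrite !bform0 mulr0.
  have V0 := posdef_gt0 V z hV z0.
  have := cmax (nrm z)^T; rewrite inE => /(_ (nrmK z z0)).
  by rewrite trmxK nrmV // ler_pdivrMr.
exists m => //; apply/eigenvalue_pencilP => //; exists c^T.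
  by apply: contra_eqN Kc => /eqP ->; rewrite bform0 eq_sym oner_eq0.
apply/esym/eqP; rewrite -subr_eq0 scalemxAl -mulmxBl; apply/eqP.
apply: bform_isotropic => [|z|].
- by rewrite raddfB /= linearZ /= VT ST.
- by rewrite bformDm bformNm bformZm subr_ge0.
- by rewrite bformDm bformNm bformZm Kc mulr1 subrr.
Qed.

Lemma bform_le_largest_eigenvalue S V lam x : S^T = S -> sym_posdef V ->
  (forall a, eigenvalue (invmx V *m S) a -> a <= lam) ->
  bform S x x <= lam * bform V x x.
Proof.
move=> ST hV hlam; have [->|x0] := eqVneq x 0; first by rewrite !bform0 mulr0.
have [m m_eig Sle] := rayleigh_max S V x ST hV x0.
by apply: (le_trans (Sle x)); rewrite ler_wpM2r ?hlam // posdef_ge0.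
Qed.

(* [T V^-1 T] has pencil eigenvalues [a ^+ 2], [a] ranging over those of [T];
   apply the previous bound to its opposite. *)
Lemma bform_ge_smallest_abs_eigenvalue T V mu x : T^T = T -> sym_posdef V ->
  0 <= mu -> (forall a, eigenvalue (invmx V *m T) a -> mu <= `|a|) ->
  mu ^+ 2 * bform V x x <= bform (invmx V) (T *m x) (T *m x).
Proof.
move=> TT hV mu0 hmu; have VT := posdef_sym V hV; have uV := posdef_unit V hV.
have hP := posdef_inv V hV; have PT := posdef_sym _ hP.
pose N := invmx V *m T; pose S := - (T *m N).
have ST : S^T = S by rewrite /S /N linearN /= !trmx_mul TT PT mulmxA.
have SE y : bform S y y = - bform (invmx V) (T *m y) (T *m y).
  by rewrite bformNm bform_mull bform_mulr TT /N mulmxA.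
suff: bform S x x <= - mu ^+ 2 * bform V x x by rewrite SE mulNr lerN2.
apply: bform_le_largest_eigenvalue => // a.
case/eigenvalue_pencilP => // y y0 Sy.
have Vy := posdef_gt0 V y hV y0.
(* [S] is negative semidefinite, so its pencil eigenvalue can be written [a = - r ^+ 2]. *)
have a_le0 : a <= 0.
  rewrite -(pmulr_lle0 _ Vy) -bformZm /bform -scalemxAr -scalemxAl.
  rewrite -mulmxA scalemxAr.
  by rewrite -Sy mulmxA -/(bform S y y) SE oppr_le0 posdef_ge0.
pose r := Num.sqrt (- a); have r2 : r ^+ 2 = - a by rewrite sqr_sqrtr ?oppr_ge0.
have NNy : N *m (N *m y) = r ^+ 2 *: y.
  rewrite {1}/N -mulmxA -[T *m _]opprK mulmxA -mulNmx -/S Sy r2.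
  by rewrite scalemxAr -mulmxN mulKmx // scaleNr.
rewrite lerNr -r2 ler_sqr ?nnegrE ?sqrtr_ge0 //.
(* Since [(N + r)(N - r) y = 0], either [y] is an eigenvector of [N] for [r], or [N *m y - r *: y]
   is one for [- r]. Both eigenvalues have absolute value [r]. *)
have [Ny|Ny] := eqVneq (N *m y) (r *: y).
  rewrite -[r]ger0_norm ?sqrtr_ge0 //.
  apply: hmu; apply/eigenvalue_pencilP => //.
  exists y => //; by rewrite scalemxAr -Ny mulmxA /N mulKVmx.
have: mu <= `|- r|; last by rewrite normrN ger0_norm // sqrtr_ge0.
apply: hmu; apply/eigenvalue_pencilP => //.
exists (N *m y - r *: y); first by rewrite subr_eq0.
rewrite -[LHS](mulKVmx uV) scalemxAr; congr (V *m _).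
rewrite mulmxA -/N mulmxBr NNy -scalemxAr scalerBr !scaleNr opprK expr2 scalerA.
by rewrite addrC.
Qed.
End PositiveDefinite.

(** * One-step contraction of the error in the [V^-1]-norm *)

Section Contraction.
Context {R : realType} {n : nat} {V W T : 'M[R]_n} {lam mu alpha : R}.
Hypotheses (hV : sym_posdef V) (hW : sym_posdef W) (TT : T^T = T).
Hypotheses (lam0 : 0 < lam) (mu0 : 0 < mu) (alpha0 : 0 < alpha).
Hypothesis W_le : forall x, bform W x x <= lam * bform V x x.
Hypothesis T_ge :
  forall x, mu ^+ 2 * bform V x x <= bform (invmx V) (T *m x) (T *m x).
Implicit Types x y u v p q : 'cV[R]_n.

Local Notation P := (invmx V).
Let VT := posdef_sym V hV.
Let WT := posdef_sym W hW.
Let uV := posdef_unit V hV.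
Let hP := posdef_inv V hV.
Let PT := posdef_sym P hP.

(** For [h = V^-1 W x], the left side [q] is both [bform V h h] and [bform W x h]. Cauchy-Schwarz
    for [W] and [W_le] at [h] give [q ^+ 2 <= bform W x x * (lam * q)], and [q] cancels when
    positive. *)
Lemma bform_inv_mul_le x : bform P (W *m x) (W *m x) <= lam * bform W x x.
Proof.
set h := P *m (W *m x); set q := bform P _ _.
have qV : q = bform V h h.
  by rewrite /h bform_mulr mulmxV // bform_mull PT mulmx1.
have qW : q = bform W x h.
  by rewrite /h [RHS]bform_mulr /q bform_mull WT.
have q0 : 0 <= q by rewrite posdef_ge0.
move: q0; rewrite le_eqVlt => /predU1P[<-|q0].
  by rewrite mulr_ge0 ?posdef_ge0 // ltW.
rewrite -(ler_pM2l q0) -expr2 {1}qW.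
apply: (le_trans (bform_CauchySchwarz W x h WT (fun z => posdef_ge0 W z hW))).
rewrite mulrCA mulrC mulrA; apply: ler_wpM2r; first exact: posdef_ge0.
by rewrite mulrC mulrC qV W_le.
Qed.

Lemma half_step_ge x : (alpha + lam) ^+ 2 * bform P (W *m x) (W *m x) <=
  lam ^+ 2 * bform P (alpha *: (V *m x) + W *m x) (alpha *: (V *m x) + W *m x).
Proof.
have PVl y : bform P (V *m x) y = bform 1%:M x y.
  by rewrite bform_mull VT mulmxV.
rewrite !(bformDl, bformDr, bformZl, bformZr).
rewrite (bformC P (W *m x) (V *m x)) // !PVl.
rewrite !bform_mulr !mul1mx.
have := bform_inv_mul_le x; have := W_le x.
rewrite (bform_mulr P W (W *m x) x).
set a := bform V x x; set b := bform W x x; set c := bform _ _ _ => hb hc.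
rewrite -subr_ge0.
(* The gap is a nonnegative combination of the two known gaps [lam * a - b] and [lam * b - c]. *)
have -> : lam ^+ 2 * (alpha * (alpha * a) + alpha * b + (alpha * b + c)) -
  (alpha + lam) ^+ 2 * c = alpha ^+ 2 * lam * (lam * a - b) +
   (alpha ^+ 2 + 2 * alpha * lam) * (lam * b - c) by ring.
by rewrite addr_ge0 // mulr_ge0 ?subr_ge0 ?addr_ge0 ?mulr_ge0 ?sqr_ge0 // ltW.
Qed.

(* The cross terms [u^T T v] of the real and imaginary parts cancel. *)
Lemma bform_rhs_eq u v :
  bform P (alpha *: (V *m u) + T *m v) (alpha *: (V *m u) + T *m v) +
  bform P (alpha *: (V *m v) - T *m u) (alpha *: (V *m v) - T *m u) =
  alpha ^+ 2 * (bform V u u + bform V v v) +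
  (bform P (T *m u) (T *m u) + bform P (T *m v) (T *m v)).
Proof.
have PVl x y : bform P (V *m x) y = bform 1%:M x y.
  by rewrite bform_mull VT mulmxV.
rewrite !(bformDl, bformDr, bformZl, bformZr, bformNl, bformNr).
rewrite (bformC P (T *m v) (V *m u)) // (bformC P (T *m u) (V *m v)) // !PVl.
rewrite !(bform_mulr 1%:M) !mul1mx (bformC T v u) //.
by ring.
Qed.

(** For errors [u + iv] at a full step and [p + iq] at the next half step, the hypotheses are the
    real and imaginary parts of the half-step error equation. The factor is the square of
    [sigma_tilde lam mu alpha]. *)
Lemma error_contraction u v p q :
  alpha *: (V *m p) + W *m p = alpha *: (V *m u) + T *m v ->
  alpha *: (V *m q) + W *m q = alpha *: (V *m v) - T *m u ->
  bform P (W *m p) (W *m p) + bform P (W *m q) (W *m q) <=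
  (lam ^+ 2 * (alpha ^+ 2 + mu ^+ 2) / ((alpha + lam) ^+ 2 * mu ^+ 2)) *
  (bform P (T *m u) (T *m u) + bform P (T *m v) (T *m v)).
Proof.
move=> hp hq; have := half_step_ge p; have := half_step_ge q.
have := bform_rhs_eq u v; rewrite hp hq; have := T_ge u; have := T_ge v.
set A1 := bform P (_ + _) _; set A2 := bform P (_ - _) _.
set U := bform P (T *m u) _; set U' := bform P (T *m v) _.
set a := bform V u u; set b := bform V v v.
set X := bform P (W *m p) _; set Y := bform P (W *m q) _.
move=> hU' hU e hY hX.
have D0 : 0 < (alpha + lam) ^+ 2 * mu ^+ 2.
  by rewrite mulr_gt0 ?exprn_gt0 ?addr_gt0.
rewrite mulrAC ler_pdivlMr //.
have -> : (X + Y) * ((alpha + lam) ^+ 2 * mu ^+ 2) =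
  mu ^+ 2 * ((alpha + lam) ^+ 2 * X + (alpha + lam) ^+ 2 * Y) by ring.
apply: (@le_trans _ _ (mu ^+ 2 * (lam ^+ 2 * A1 + lam ^+ 2 * A2))).
  by apply: ler_wpM2l; [exact: sqr_ge0|exact: lerD].
rewrite -mulrDr e -subr_ge0.
(* The remaining slack is a nonnegative multiple of the gaps in [T_ge] at [u] and [v]. *)
have -> : lam ^+ 2 * (alpha ^+ 2 + mu ^+ 2) * (U + U') -
  mu ^+ 2 * (lam ^+ 2 * (alpha ^+ 2 * (a + b) + (U + U'))) =
  lam ^+ 2 * alpha ^+ 2 * ((U - mu ^+ 2 * a) + (U' - mu ^+ 2 * b)) by ring.
rewrite -exprMn; apply: mulr_ge0; first exact: sqr_ge0.
by rewrite addr_ge0 ?subr_ge0.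
Qed.

End Contraction.

(** * Minimization of the bound [sigma_tilde] *)

Section Sigma.
Context {R : realType} {lam mu : R}.
Hypotheses (lam0 : 0 < lam) (mu0 : 0 < mu).

Lemma sigma_tilde_sqr (alpha : R) : sigma_tilde lam mu alpha ^+ 2 =
  lam ^+ 2 * (alpha ^+ 2 + mu ^+ 2) / ((alpha + lam) ^+ 2 * mu ^+ 2).
Proof.
rewrite /sigma_tilde !(exprMn, exprVn) sqr_sqrtr ?addr_ge0 ?sqr_ge0 //.
by rewrite mulrACA -!invfM.
Qed.

Lemma sigma_tilde_sqr_star :
  sigma_tilde lam mu (mu ^+ 2 / lam) ^+ 2 = lam ^+ 2 / (lam ^+ 2 + mu ^+ 2).
Proof.
rewrite sigma_tilde_sqr; field.
by rewrite !gt_eqF // ?addr_gt0 ?exprn_gt0.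
Qed.

(** Both values are nonnegative, so their squares may be compared. After clearing denominators the
    difference is a perfect square, zero exactly at [alpha = mu ^+ 2 / lam]. *)
Lemma sigma_tilde_min (alpha : R) : 0 < alpha ->
  sigma_tilde lam mu (mu ^+ 2 / lam) <= sigma_tilde lam mu alpha.
Proof.
move=> alpha0.
have s0 (a : R) : 0 < a -> 0 <= sigma_tilde lam mu a.
  move=> a0; rewrite /sigma_tilde mulr_ge0 ?divr_ge0 ?sqrtr_ge0 ?ltW //.
  exact: addr_gt0.
rewrite -ler_sqr ?nnegrE ?s0 ?divr_gt0 ?exprn_gt0 //.
rewrite sigma_tilde_sqr_star sigma_tilde_sqr.
have l2 : 0 < lam ^+ 2 by rewrite exprn_gt0.
have m2 : 0 < mu ^+ 2 by rewrite exprn_gt0.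
have al := addr_gt0 alpha0 lam0.
have al2 : 0 < (alpha + lam) ^+ 2 by rewrite exprn_gt0.
rewrite ler_pdivlMr ?mulr_gt0 // mulrAC ler_pdivrMr ?addr_gt0 //.
rewrite -subr_ge0.
have -> : lam ^+ 2 * (alpha ^+ 2 + mu ^+ 2) * (lam ^+ 2 + mu ^+ 2) -
  lam ^+ 2 * ((alpha + lam) ^+ 2 * mu ^+ 2) =
  (lam * (alpha * lam - mu ^+ 2)) ^+ 2 by ring.
exact: sqr_ge0.
Qed.

End Sigma.

(** * Real and imaginary parts of complex vectors, and entrywise convergence *)

Local Notation ReV := (map_mx (@complex.Re _)).
Local Notation ImV := (map_mx (@complex.Im _)).

Section ComplexVectors.
Context {R : realType}.

Lemma cRe_add (x y : R[i]) : complex.Re (x + y) = complex.Re x + complex.Re y.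
Proof. by case: x y => [a b] [c d]. Qed.

Lemma cIm_add (x y : R[i]) : complex.Im (x + y) = complex.Im x + complex.Im y.
Proof. by case: x y => [a b] [c d]. Qed.

Lemma cRe_realM (a : R) (x : R[i]) : complex.Re (a%:C * x) = a * complex.Re x.
Proof. by case: x => [c d] /=; rewrite mul0r subr0. Qed.

Lemma cIm_realM (a : R) (x : R[i]) : complex.Im (a%:C * x) = a * complex.Im x.
Proof. by case: x => [c d] /=; rewrite mul0r addr0. Qed.

Context {n : nat}.
Implicit Types (M : 'M[R]_n) (z : 'cV[R[i]]_n).

Lemma ReVD z1 z2 : ReV (z1 + z2) = ReV z1 + ReV z2.
Proof. by apply/matrixP => i j; rewrite !mxE cRe_add. Qed.

Lemma ImVD z1 z2 : ImV (z1 + z2) = ImV z1 + ImV z2.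
Proof. by apply/matrixP => i j; rewrite !mxE cIm_add. Qed.

Lemma ReVZ (a : R) z : ReV (a%:C *: z) = a *: ReV z.
Proof. by apply/matrixP => i j; rewrite !mxE cRe_realM. Qed.

Lemma ImVZ (a : R) z : ImV (a%:C *: z) = a *: ImV z.
Proof. by apply/matrixP => i j; rewrite !mxE cIm_realM. Qed.

Lemma ReVi z : ReV ('i%C *: z) = - ImV z.
Proof. by apply/matrixP => i j; rewrite !mxE mulrC complex.ReiNIm. Qed.

Lemma ImVi z : ImV ('i%C *: z) = ReV z.
Proof. by apply/matrixP => i j; rewrite !mxE mulrC complex.ImiRe. Qed.

Lemma ReVN z : ReV (- z) = - ReV z.
Proof. by apply/matrixP => i j; rewrite !mxE; case: (z i j). Qed.

Lemma ImVN z : ImV (- z) = - ImV z.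
Proof. by apply/matrixP => i j; rewrite !mxE; case: (z i j). Qed.

Lemma ReV_mul M z : ReV (complexify M *m z) = M *m ReV z.
Proof.
apply/matrixP => i j; rewrite !mxE (big_morph _ cRe_add (erefl _)).
by apply: eq_bigr => k _; rewrite !mxE cRe_realM.
Qed.

Lemma ImV_mul M z : ImV (complexify M *m z) = M *m ImV z.
Proof.
apply/matrixP => i j; rewrite !mxE (big_morph _ cIm_add (erefl _)).
by apply: eq_bigr => k _; rewrite !mxE cIm_realM.
Qed.

Lemma complexV_eq0 z : ReV z = 0 -> ImV z = 0 -> z = 0.
Proof.
move=> /matrixP hR /matrixP hI; apply/matrixP => i j.
move: (hR i j) (hI i j); rewrite !mxE; case: (z i j) => a b /= -> ->.
by [].
Qed.

Definition ReIm_simpl :=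
  (ReVD, ImVD, ReVZ, ImVZ, ReVi, ImVi, ReVN, ImVN, ReV_mul, ImV_mul).

Lemma complexify_unit M : M \in unitmx -> complexify M \in unitmx.
Proof. by rewrite map_unitmx. Qed.

Lemma cvg_geometric_cV (x : nat -> 'cV[R[i]]_n) (xs : 'cV[R[i]]_n)
    (C r : R) : 0 <= r < 1 ->
  (forall k i, complex.Re ((x k - xs) i 0) ^+ 2 +
     complex.Im ((x k - xs) i 0) ^+ 2 <= C * r ^+ k) ->
  (x @ \oo --> xs)%classic.
Proof.
move=> /andP[r0 r1] hx; apply/cvg_ballP => e e0.
(* The radius [e] lives in [R[i]], where [0 < e] forces a zero imaginary part. *)
have eE : e = (complex.Re e)%:C.
  by move: e0; case: (e) => a b; rewrite ltcE /= => /andP[/eqP -> _].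
have re0 : 0 < complex.Re e by move: e0; rewrite ltcE => /andP[].
have cv : (geometric C r @ \oo --> (0 : R))%classic.
  by apply: cvg_geometric; rewrite ger0_norm.
near=> k.
have Ck : C * r ^+ k < complex.Re e ^+ 2.
  near: k; apply: (cvgr_lt _ cv); exact: exprn_gt0.
split=> // i j; rewrite ord1.
rewrite -ball_normE /= eE normc_def ltcR.
rewrite -[ltRHS]gtr0_norm // -sqrtr_sqr ltr_sqrt ?exprn_gt0 //.
apply: le_lt_trans Ck; apply: le_trans (hx k i); rewrite !mxE.
rewrite le_eqVlt; apply/orP; left; apply/eqP.
by case: (xs i 0) (x k i 0) => [a b] [c d] /=; ring.
Unshelve. all: by end_near. Qed.

End ComplexVectors.

(** Regrouping for the half-step error equation, where [s] stands for [W] applied to the solution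
    and cancels. *)
Lemma subr_shift {U : zmodType} (p q s t u : U) :
  p - q + (s + t) - (u + s) = p - u - (q - t).
Proof.
rewrite (addrC s) addrA (addrC u) addrKA opprB addrA.
by rewrite [LHS]addrAC [p - q - u]addrAC [LHS]addrAC.
Qed.

(** * Optimality of the parameter and convergence of the iteration *)

Theorem theorem3p2 (R : realType) (n : nat) (W T V : 'M[R]_n)
    (lam_max mu_min : R)
    (hW : sym_posdef W)
    (hTsym : T \is symmetricmx)
    (hTindef : indefinite T)
    (hTunit : T \in unitmx)
    (hV : sym_posdef V)
    (hlam : largest_eigenvalue (invmx V *m W) lam_max)
    (hmu : smallest_abs_eigenvalue (invmx V *m T) mu_min) :
  let A : 'M[R[i]]_n := complexify W + 'i%C *: complexify T in
  let alpha_star : R := mu_min ^+ 2 / lam_max in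
  [/\ 0 < mu_min,
      0 < alpha_star,
      forall alpha : R, 0 < alpha ->
        sigma_tilde lam_max mu_min alpha_star <=
        sigma_tilde lam_max mu_min alpha &
      plhss_converges V W T alpha_star A].
Proof.
move=> A alpha_star.
have TT : T^T = T by apply/symmetricmxP.
have [VT WT] := (posdef_sym V hV, posdef_sym W hW).
have uV := posdef_unit V hV.
case: hlam => lam_eig lam_ub; case: hmu => -[a a_eig mu_a] mu_lb.
have lam0 : 0 < lam_max.
  case/eigenvalue_pencilP: lam_eig => // x x0 Wx.
  rewrite -(pmulr_lgt0 _ (posdef_gt0 V x hV x0)).
  by have := posdef_gt0 W x hW x0; rewrite /bform -!mulmxA Wx -scalemxAr mxE.
have mu0 : 0 < mu_min.
  rewrite mu_a normr_gt0; case/eigenvalue_pencilP: a_eig => // x x0 Tx.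
  apply: contraNneq x0 => a0.
  by rewrite -[x](mulKmx hTunit) Tx a0 scale0r mulmx0.
have alpha0 : 0 < alpha_star by rewrite divr_gt0 ?exprn_gt0.
split=> // [alpha|]; first exact: sigma_tilde_min.
have W_le x := bform_le_largest_eigenvalue W V lam_max x WT hV lam_ub.
have T_ge x :=
  bform_ge_smallest_abs_eigenvalue T V mu_min x TT hV (ltW mu0) mu_lb.
have hP := posdef_inv V hV.
(* Pairing the imaginary and real parts of [A *m z = 0] with those of [z] cancels the [T] terms, so
   the [W]-forms of both parts sum to zero; positive definiteness gives [z = 0]. *)
have uA : A \in unitmx.
  apply: unitmx_ker0 => z Az.
  have := congr1 ReV Az.
  have := congr1 ImV Az.
  rewrite /A mulmxDl -scalemxAl !ReIm_simpl !map_mx0 //.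
  set u := map_mx _ z; set v := map_mx _ z => /eqP; rewrite addr_eq0 => /eqP Wv.
  move=> /eqP; rewrite subr_eq0 => /eqP Wu.
  have uv0 : bform W u u + bform W v v = 0.
    rewrite -[W]mul1mx -!bform_mulr Wu Wv bformNr !bform_mulr !mul1mx.
    by rewrite (bformC T v u) // addNr.
  have [Wu0 Wv0] := (posdef_ge0 W u hW, posdef_ge0 W v hW).
  by apply: complexV_eq0; apply: (posdef_eq0 W) => //; lra.
have uM : alpha_star%:C *: complexify V + complexify W \in unitmx.
  rewrite (_ : _ + _ = complexify (alpha_star *: V + W)).
    exact/complexify_unit/posdef_unit/posdefD.
  by rewrite /complexify map_mxD map_mxZ.
have uT : complexify T \in unitmx by exact: complexify_unit.
move=> b x0; exists (invmx A *m b); set xs := invmx A *m b.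
have Axs : A *m xs = b by rewrite mulKVmx.
split=> //.
- by move=> z Az; rewrite /xs -Az mulKmx.
- pose half x := invmx (alpha_star%:C *: complexify V + complexify W) *m
    ((alpha_star%:C *: complexify V - 'i%C *: complexify T) *m x + b).
  pose next x := invmx (complexify T) *m
    ('i%C *: (complexify W *m half x) - 'i%C *: b).
  exists (fun k => iter k next x0), (fun k => half (iter k next x0)).
  by split=> // k; rewrite /half mulKVmx //; split=> //=; rewrite /next mulKVmx.
move=> x y [_ xy].
have [e eE] : exists e, forall k, e k = x k - xs by exists (fun k => x k - xs).
have [f fE] : exists f, forall k, f k = y k - xs by exists (fun k => y k - xs).
(* The solution [xs] is a fixed point of both half steps, so subtracting its equations removes
   [b]. *)
have halfE k : alpha_star%:C *: (complexify V *m f k) + complexify W *m f k =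
    alpha_star%:C *: (complexify V *m e k) - 'i%C *: (complexify T *m e k).
  have [+ _] := xy k; rewrite -Axs !mulmxDl mulNmx -!scalemxAl eE fE !mulmxBr.
  rewrite !scalerBr => h; rewrite addrACA -opprD h.
  exact: subr_shift.
have nextE k : complexify T *m e k.+1 = 'i%C *: (complexify W *m f k).
  have [_ h] := xy k; rewrite eE fE !mulmxBr h -Axs mulmxDl -scalemxAl.
  rewrite !scalerBr scalerDr scalerA -expr2 sqr_i scaleN1r.
  by rewrite opprD opprK addrA addrK.
pose P := invmx V.
pose Phi k := bform P (T *m ReV (e k)) (T *m ReV (e k)) +
  bform P (T *m ImV (e k)) (T *m ImV (e k)).
pose r := sigma_tilde lam_max mu_min alpha_star ^+ 2.
have r01 : 0 <= r < 1.
  rewrite /r sigma_tilde_sqr_star // divr_ge0 ?addr_ge0 ?sqr_ge0 //=.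
  by rewrite ltr_pdivrMr ?addr_gt0 ?exprn_gt0 // mul1r ltrDl exprn_gt0.
have [r0 r1] := andP r01.
have PhiS k : Phi k.+1 <= r * Phi k.
  have := congr1 ReV (halfE k).
  have := congr1 ImV (halfE k).
  have := congr1 ReV (nextE k).
  have := congr1 ImV (nextE k).
  (* Multiplication by the imaginary unit swaps real and imaginary parts up to sign, which leaves
     the sum of the two forms unchanged. *)
  rewrite !ReIm_simpl opprK /Phi => -> -> hI hR.
  rewrite bformNl bformNr opprK addrC /r sigma_tilde_sqr.
  by apply:
    (error_contraction hV hW TT lam0 mu0 alpha0 W_le T_ge _ _ _ _ hR hI).
have Phik k : Phi k <= r ^+ k * Phi 0%N.
  elim: k => [|k IH]; first by rewrite mul1r.
  by rewrite exprS -mulrA (le_trans (PhiS k)) // ler_wpM2l.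
(* Coordinate [i] alone needs only its own summand; the sum gives one constant for all
   coordinates. *)
pose C := \sum_i P i i / mu_min ^+ 2 * Phi 0%N.
apply: (cvg_geometric_cV x xs C r r01) => k i.
have mu2 : 0 < mu_min ^+ 2 by rewrite exprn_gt0.
have Pge0 j : 0 <= P j j by rewrite -bform_delta posdef_ge0.
have Phi0 : 0 <= Phi 0%N by rewrite addr_ge0 // posdef_ge0.
apply: (@le_trans _ _ (P i i / mu_min ^+ 2 * Phi k)); last first.
  apply: (@le_trans _ _ (P i i / mu_min ^+ 2 * Phi 0%N * r ^+ k)).
    by rewrite -[leRHS]mulrA [Phi 0%N * _]mulrC ler_wpM2l ?divr_ge0 // ltW.
  apply: ler_wpM2r; first exact: exprn_ge0.
  rewrite /C (bigD1 i) //= lerDl sumr_ge0 // => j _.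
  by rewrite mulr_ge0 ?divr_ge0 // ltW.
have coord (u : 'cV[R]_n) :
    u i 0 ^+ 2 <= P i i / mu_min ^+ 2 * bform P (T *m u) (T *m u).
  apply: (le_trans (posdef_coord_le V u i hV)).
  by rewrite -mulrA ler_wpM2l // ler_pdivlMl.
have := lerD (coord (ReV (e k))) (coord (ImV (e k))).
by rewrite -mulrDr -eE !mxE.
Qed.
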